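(* Let $d,b,k,n\in\mathbb{N}$ and $0<\delta\le 1$. There exists an estimator $V_n\in\mathcal{H}_{d,b}^k$ such that $$\sup_{p\in\mathcal{D}_d}P\left(\|p-V_n\|_1>3\min_{q\in\mathcal{H}_{d,b}^k}\|p-q\|_1+7\sqrt{\frac{2bdk\log(4bdkn)}{n}}+7\sqrt{\frac{\log(\frac{3}{\delta})}{2n}}\right)<\delta,$$ where $V_n$ is a function of $X_1,\ldots,X_n\overset{iid}{\sim}p$.
   Context: $\mathbb{N}$ denotes the positive integers, $[b]=\{1,\ldots,b\}$, and $\log$ is the natural logarithm. $\mathcal{D}_d$ is the set of all probability densities on $[0,1)^d$ (with respect to $d$-dimensional Lebesgue measure); $\|\cdot\|_1$ is the $L^1$ norm. $\Delta_k$ is the set of vectors in $\mathbb{R}^k$ with nonnegative entries summing to one. For $i\in[b]$, let $h_{1,b,i}(x)=b\,\mathbf{1}\left(\frac{i-1}{b}\le x<\frac{i}{b}\right)$ on $[0,1)$, and let $\mathcal{H}_{1,b}$ be the convex hull of $\{h_{1,b,i}: i\in[b]\}$. For univariate functions, $\prod_{j=1}^d p_j$ denotes $(x_1,\ldots,x_d)\mapsto\prod_{j=1}^d p_j(x_j)$. The set of multi-view histograms is $$\mathcal{H}_{d,b}^k=\left\{\sum_{i=1}^k w_i\prod_{j=1}^d p_{i,j}\;:\; w\in\Delta_k,\ p_{i,j}\in\mathcal{H}_{1,b}\right\}.$$ An estimator $V_n\in\mathcal{H}_{d,b}^k$ is a function of the sample (not depending on $p$) with values in $\mathcal{H}_{d,b}^k$.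 *)

(* Defs.v *)
From HB Require Import structures.
From mathcomp Require Import all_boot all_order all_algebra.
From mathcomp Require Import all_classical all_reals all_analysis.
From mathcomp Require Import measurable_realfun.

Set Implicit Arguments.
Unset Strict Implicit.
Unset Printing Implicit Defensive.
Import Order.TTheory GRing.Theory Num.Theory.
Import numFieldNormedType.Exports.
Local Open Scope classical_set_scope.
Local Open Scope ring_scope.

Section cons_measure.
Context d (T : measurableType d) (R : realType) (n : nat).
Variables (mu : {sigma_finite_measure set T -> \bar R})
          (nu : {sigma_finite_measure set (n.-tuple T) -> \bar R}).

Definition tuple_cons (z : T * n.-tuple T) : n.+1.-tuple T :=
  [the n.+1.-tuple T of z.1 :: z.2].

Lemma measurable_tuple_cons : measurable_fun setT tuple_cons.
Proof. exact: measurable_cons. Qed.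

Definition cons_measure : set (n.+1.-tuple T) -> \bar R :=
  pushforward (mu \x nu)%E tuple_cons.

Let cons_measure0 : cons_measure set0 = 0%E.
Proof. by rewrite /cons_measure /pushforward preimage_set0 measure0. Qed.

Let cons_measure_ge0 A : (0 <= cons_measure A)%E.
Proof. by rewrite /cons_measure /pushforward; exact: measure_ge0. Qed.

Let cons_measure_sigma_additive : semi_sigma_additive cons_measure.
Proof.
move=> F mF tF mUF; rewrite /cons_measure /pushforward preimage_bigcup.
apply: measure_semi_sigma_additive.
- by move=> i; rewrite -[X in measurable X]setTI; exact: measurable_tuple_cons.
- apply/trivIsetP => /= i j _ _ ij; rewrite -preimage_setI.
  by move/trivIsetP : tF => /(_ _ _ _ _ ij) ->//; rewrite preimage_set0.
- rewrite -preimage_bigcup -[X in measurable X]setTI.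
  exact: measurable_tuple_cons.
Qed.

HB.instance Definition _ := isMeasure.Build _ _ _ cons_measure
  cons_measure0 cons_measure_ge0 cons_measure_sigma_additive.

Let cons_measure_sigma_finite : sigma_finite setT cons_measure.
Proof.
have /sigma_finiteP[F [TF ndF Foo]] := sigma_finiteT mu.
have /sigma_finiteP[G [TG ndG Goo]] := sigma_finiteT nu.
pose g (t : n.+1.-tuple T) := (thead t, [tuple of behead t]).
have mg : measurable_fun setT g.
  apply: measurable_fun_pair; first exact: measurable_tnth.
  exact: measurable_behead.
have gK z : g (tuple_cons z) = z.
  by case: z => x t; rewrite /g /tuple_cons; congr pair; exact/val_inj.
exists (fun i => g @^-1` (F i `*` G i)).
  rewrite -preimage_bigcup (_ : \bigcup_i _ = setT) ?preimage_setT//.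
  apply/seteqP; split => // -[x t] _.
  have [i _ Fix] : (\bigcup_i F i) x by rewrite -TF.
  have [j _ Gjt] : (\bigcup_j G j) t by rewrite -TG.
  exists (maxn i j) => //; split.
    by move: x Fix; exact/subsetPset/ndF/leq_maxl.
  by move: t Gjt; exact/subsetPset/ndG/leq_maxr.
move=> i; have [mFi Fioo] := Foo i; have [mGi Gioo] := Goo i; split.
  by rewrite -[X in measurable X]setTI; apply: mg => //; exact: measurableX.
rewrite /cons_measure /pushforward -comp_preimage.
rewrite (_ : g \o tuple_cons = id); last by apply/funext => z /=; rewrite gK.
by rewrite preimage_id product_measure1E// lte_mul_pinfty// ge0_fin_numE.
Qed.

HB.instance Definition _ := Measure_isSigmaFinite.Build _ _ _ cons_measure
  cons_measure_sigma_finite.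

End cons_measure.

Fixpoint power_measure d (T : measurableType d) (R : realType)
    (mu : {sigma_finite_measure set T -> \bar R}) (n : nat) :
    {sigma_finite_measure set (n.-tuple T) -> \bar R} :=
  match n with
  | 0 => \d_([tuple] : 0.-tuple T)
  | n'.+1 => cons_measure mu (power_measure mu n')
  end.

Lemma power_measure_box d (T : measurableType d) (R : realType)
    (mu : {sigma_finite_measure set T -> \bar R}) n (A : 'I_n -> set T) :
  (forall i, measurable (A i)) ->
  power_measure mu n [set t | forall i, A i (tnth t i)] =
  (\prod_(i < n) mu (A i))%E.
Proof.
elim: n A => [|n ih] A mA.
  by rewrite big_ord0 /= diracE mem_set// => -[].
rewrite big_ord_recl /= -ih//.
pose B := [set t : n.-tuple T | forall i, A (lift ord0 i) (tnth t i)].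
have mB : measurable B.
  rewrite (_ : B = \bigcap_(i in setT)
      ((@tnth n T)^~ i @^-1` A (lift ord0 i))).
    apply: fin_bigcap_measurable => // i _.
    by rewrite -[X in measurable X]setTI; exact: measurable_tnth.
  by apply/seteqP; split => t /= Bt; [move=> i _|move=> i]; exact: Bt.
rewrite -product_measure1E// /cons_measure /pushforward; congr (_ _).
apply/seteqP; split => -[x t] /=.
  move=> h; split; first exact: (h ord0).
  by move=> i; have := h (lift ord0 i); rewrite /tuple_cons tnthS.
move=> [Ax Bt] i; case: (unliftP ord0 i) => [j|] ->; last exact: Ax.
by rewrite /tuple_cons tnthS; exact: Bt.
Qed.

Notation eucl R d := (d.-tuple (measurableTypeR R)).

Section densities.
Context (R : realType) (d : nat).

Definition lebesgue_eucl : {sigma_finite_measure set (eucl R d) -> \bar R} :=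
  power_measure (@lebesgue_measure R) d.

Definition unit_cube : set (eucl R d) :=
  [set x | forall j, `[0, 1[%classic (tnth x j)].

(* Functions on [0,1)^d are identified with their extension by 0 to R^d; the
   elements of [mvhist] below also vanish outside the cube when [0 < d]. *)
Record density := Density {
  density_fun :> eucl R d -> R ;
  measurable_density : measurable_fun setT density_fun ;
  density_ge0 : forall x, 0 <= density_fun x ;
  density_out : forall x, ~ unit_cube x -> density_fun x = 0 ;
  integral_density : (\int[lebesgue_eucl]_x (density_fun x)%:E)%E = 1%E }.

Definition L1dist (p q : eucl R d -> R) : \bar R :=
  ('N[lebesgue_eucl]_1[(fun x => (p x - q x)%:E)])%E.

Section law.
Variable p : density.

Definition density_law (A : set (eucl R d)) : \bar R :=
  (\int[lebesgue_eucl]_(x in A) (p x)%:E)%E.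

Let density_law0 : density_law set0 = 0%E.
Proof. exact: integral_set0. Qed.

Let density_law_ge0 A : (0 <= density_law A)%E.
Proof. by apply: integral_ge0 => x _; rewrite lee_fin density_ge0. Qed.

Let density_law_sigma_additive : semi_sigma_additive density_law.
Proof.
apply: semi_sigma_additive_nng_induced => [|x]; last first.
  by rewrite lee_fin density_ge0.
by apply/measurable_EFinP; exact: measurable_density.
Qed.

HB.instance Definition _ := isMeasure.Build _ _ _ density_law
  density_law0 density_law_ge0 density_law_sigma_additive.

Let density_law_setT : density_law setT = 1%E.
Proof. exact: integral_density. Qed.

HB.instance Definition _ := Measure_isProbability.Build _ _ _ density_law
  density_law_setT.

End law.

(* The law of (X_1, ..., X_n) for X_1, ..., X_n i.i.d. with density p *)
Definition sample_law (p : density) (n : nat) :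
    {sigma_finite_measure set (n.-tuple (eucl R d)) -> \bar R} :=
  power_measure (density_law p) n.

End densities.

Section histograms.
Context (R : realType).

Definition simplex (k : nat) : set ('I_k -> R) :=
  [set w | (forall i, 0 <= w i) /\ \sum_(i < k) w i = 1].

Definition convex_hull (T : Type) (A : set (T -> R)) : set (T -> R) :=
  [set f | exists (m : nat) (w : 'I_m -> R) (g : 'I_m -> T -> R),
    [/\ simplex w, (forall i, A (g i)) &
        f = fun x => \sum_(i < m) w i * g i x]].

(* The bins are indexed from 0. *)
Definition bin (b : nat) (i : 'I_b) : R -> R :=
  fun x => b%:R * \1_(`[i%:R / b%:R, i.+1%:R / b%:R[%classic) x.

Definition hist1 (b : nat) : set (R -> R) := convex_hull (range (@bin b)).

Definition mvhist (d b k : nat) : set (eucl R d -> R) :=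
  [set f | exists (w : 'I_k -> R) (p : 'I_k -> 'I_d -> R -> R),
    [/\ simplex w, (forall i j, hist1 b (p i j)) &
        f = fun x => \sum_(i < k) w i * \prod_(j < d) p i j (tnth x j)]].

End histograms.

Arguments mvhist : clear implicits.

(* When [A] has no minimum the value is -oo, so that an upper bound in terms of
   [minimum A] cannot hold for lack of a minimum. *)
Definition minimum (R : realType) (A : set (\bar R)) : \bar R :=
  xget -oo%E [set m | A m /\ lbound A m].

(* Joint measurability makes [s |-> L1dist p (V s)] measurable, so that events
   about the L1 error of [V] have a well-defined probability. *)
Definition is_estimator (R : realType) (d b k n : nat)
    (V : n.-tuple (eucl R d) -> eucl R d -> R) : Prop :=
  (forall s, mvhist R d b k (V s)) /\
  measurable_fun setT (fun z : n.-tuple (eucl R d) * eucl R d => V z.1 z.2).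

(* Main.v *)
Require Import Defs.
From mathcomp Require Import all_boot all_order all_algebra.
From mathcomp Require Import all_classical all_reals all_analysis.
From mathcomp Require Import measurable_realfun ring lra.

(** The estimator is a minimum-distance estimate over a finite net of
    histograms.

    A multi-view histogram is a mixture, over the b^d cells of the cube, of the
    uniform densities of the cells; the mass of a cell is a polynomial in the
    k + k d b parameters (mixing weights and bin masses), which range over a
    compact product of simplices ([mvhistP]). Hence the L1 distance to a fixed
    density is continuous in the parameters and attains its minimum
    ([best_histogram]). Since every factor of a product of densities can be
    exchanged at a cost equal to its own L1 error, moving each parameter by at
    most e moves the histogram by at most (k + d b) e in L1
    ([cell_mass_lipschitz]). Cutting the parameter space into small boxes and
    keeping one histogram for each box gives a finite family of M histograms
    that is dense up to (k + d b) / N ([histogram_net]).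

    Among finitely many candidates f_i, choose the one whose masses on the
    Yatracos sets {f_i > f_j} are uniformly closest to the empirical
    frequencies. If all these frequencies are within t of their expectations,
    the chosen candidate is within 3 min_i |p - f_i| + 4 t of p
    ([minimum_distance_bound]): the L1 distance between two candidates is read
    off two Yatracos sets, and a set sees only half of the L1 distance between
    two densities ([scheffe_bound]). By Hoeffding's inequality ([hoeffding])
    and a union bound over the M^2 pairs, the frequencies fail to be that close
    with probability at most 2 M^2 exp (- 2 n t^2)
    ([minimum_distance_tail]). For t^2 = ln (3 M^2 / delta) / (2 n) this is
    2 delta / 3, which leaves the strict inequality, and with
    N = 4 b d k n - 1 the errors 4 t and 3 (k + d b) / N add up to at most
    the announced rates ([rate_bound]).

    A sample matters only through the finite pattern telling which of its
    points lie in which Yatracos sets. This makes measurability immediate and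
    turns the concentration inequality into an inequality between finite
    sums. *)

Import Order.TTheory GRing.Theory Num.Theory.
Import numFieldNormedType.Exports.
Local Open Scope classical_set_scope.
Local Open Scope ring_scope.

Set Implicit Arguments.
Unset Strict Implicit.
Unset Printing Implicit Defensive.

(** * Finitely valued maps *)

Section finitely_valued.
Context d (S : measurableType d) (C : finType) (F : S -> C).

Lemma finitely_valued_preimageE (Q : pred C) :
  [set s | Q (F s)] = \big[setU/set0]_(c | Q c) (F @^-1` [set c]).
Proof.
rewrite -bigcup_seq_cond; apply/seteqP; split => s /=.
  by move=> Qs; exists (F s) => //=; rewrite mem_index_enum.
by move=> [c /= /andP[_ Qc] ->].
Qed.

Hypothesis mF : forall c, measurable (F @^-1` [set c]).

Lemma measurable_finitely_valued (Q : pred C) : measurable [set s | Q (F s)].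
Proof. by rewrite finitely_valued_preimageE; exact: bigsetU_measurable. Qed.

Lemma measurable_finite_selection d' (T : measurableType d') (R : realType)
    (g : C -> T -> R) : (forall c, measurable_fun setT (g c)) ->
  measurable_fun setT (fun z : S * T => g (F z.1) z.2).
Proof.
move=> mg.
rewrite (_ : (fun z => _) = fun z : S * T =>
    \sum_(c : C) \1_(F @^-1` [set c]) z.1 * g c z.2).
  apply: measurable_sum => c; apply: measurable_funM.
    have mi : measurable_fun setT (\1_(F @^-1` [set c]) : S -> R).
      exact: measurable_indic.
    exact: (measurableT_comp mi measurable_fst).
  exact: (measurableT_comp (mg c) measurable_snd).
apply/funext => z; rewrite (bigD1 (F z.1))//= big1 => [|c cF].
  by rewrite indicE mem_set// mul1r addr0.
by rewrite indicE memNset ?mul0r//= => h; move: cF; rewrite h eqxx.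
Qed.
End finitely_valued.

(** * Hoeffding's inequality for empirical frequencies *)

Section bernoulli.
Context {R : realType}.

Lemma is_derive_ge0_ndecr (f f' : R -> R) :
  (forall x : R, is_derive x 1 f (f' x)) -> (forall x, 0 <= x -> 0 <= f' x) ->
  forall x, 0 <= x -> f 0 <= f x.
Proof.
move=> df f'0 x x0.
have cf : {within `[0, x], continuous f}.
  apply: continuous_subspaceT => y.
  by apply: differentiable_continuous; apply/derivable1_diffP; case: (df y).
have [c /itvP c0x fE] := MVT_segment x0 (fun y _ => df y) cf.
by rewrite -subr_ge0 fE mulr_ge0 ?subr_ge0// f'0 ?c0x.
Qed.

(** Hoeffding's lemma for a centred Bernoulli variable. The logarithm of its
    moment generating function vanishes to first order at 0, and its second
    derivative is u (1 - u) <= 1/4, where u is the success probability of the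
    exponentially tilted law. *)
Lemma bernoulli_mgf (p l : R) : 0 <= p <= 1 -> 0 <= l ->
  (1 - p) * expR (- (l * p)) + p * expR (l * (1 - p)) <= expR (l ^+ 2 / 8).
Proof.
move=> /andP[p0 p1] l0.
pose D (x : R) := (1 - p) + p * expR x.
have D0 x : 0 < D x.
  rewrite /D; have [->|pn0] := eqVneq p 0; first by rewrite mul0r subr0 addr0.
  by rewrite ltr_wpDl ?subr_ge0// mulr_gt0 ?expR_gt0// lt_def pn0.
have dD (x : R) : is_derive x 1 D (p * expR x).
  have := is_deriveD (is_derive_cst (1 - p) x 1) (is_deriveZ p (is_derive_expR x)).
  by rewrite add0r; apply.
(* [f] is the gap between the logarithms of the two sides, [g] its derivative. *)
pose g (x : R) := x / 4 + p - p * expR x / D x.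
pose f (x : R) := x ^+ 2 / 8 + x * p - ln (D x).
have dg (x : R) : is_derive x 1 g (4^-1 - p * expR x / D x * (1 - p * expR x / D x)).
  have Dx0 : D x != 0 by rewrite gt_eqF.
  have dlin := is_deriveD (is_deriveZ 4^-1 (is_derive_id x 1)) (is_derive_cst p x 1).
  have dquo := is_deriveM (is_deriveZ p (is_derive_expR x)) (is_deriveV Dx0 (dD x)).
  have -> : g = 4^-1 *: id + cst p - p *: (expR : R -> R) * (fun y => (D y)^-1).
    by apply/funext => y; rewrite /g mulrC.
  apply: is_derive_eq (is_deriveB dlin dquo) _.
  rewrite /GRing.scale/= /GRing.scale/=; field.
  exact: Dx0.
have df (x : R) : is_derive x 1 f (g x).
  have dln := is_derive1_comp (is_derive1_ln (D0 x)) (dD x).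
  have dquad := is_deriveD (is_deriveZ 8^-1 (is_deriveX 2 (is_derive_id x 1)))
    (is_deriveZ p (is_derive_id x 1)).
  have -> : f = 8^-1 *: (id ^+ 2) + p *: id - (@ln R \o D).
    by apply/funext => y; rewrite /f mulrC [_ * p]mulrC.
  apply: is_derive_eq (is_deriveB dquad dln) _.
  rewrite /g /GRing.scale/= /GRing.scale/= expr1; field.
  by rewrite gt_eqF.
have g0 x : 0 <= x -> 0 <= g x.
  move=> x0; have -> : 0 = g 0 by rewrite /g /D expR0 mulr1 subrK mul0r add0r divr1 subrr.
  apply: (is_derive_ge0_ndecr dg) => // y _.
  set u := _ / _.
  have := sqr_ge0 (u - 2^-1); nra.
have : f 0 <= f l by apply: (is_derive_ge0_ndecr df).
rewrite /f {1}/D expR0 mulr1 subrK ln1 expr0n/= !mul0r addr0 subr0 subr_ge0 => h.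
have -> : (1 - p) * expR (- (l * p)) + p * expR (l * (1 - p)) = expR (ln (D l) - l * p).
  rewrite expRB lnK ?posrE// -expRN [in RHS]mulrDl -[in RHS]mulrA -expRD.
  by congr (_ + _ * expR _); ring.
by rewrite ler_expR lerBlDr.
Qed.
End bernoulli.

Lemma measure_bigsetU_le d (T : measurableType d) (R : realType)
    (mu : {measure set T -> \bar R}) (I : Type) (r : seq I) (Q : pred I)
    (F : I -> set T) : (forall i, measurable (F i)) ->
  (mu (\big[setU/set0]_(i <- r | Q i) F i) <= \sum_(i <- r | Q i) mu (F i))%E.
Proof.
move=> mF; elim: r => [|i r ih]; first by rewrite !big_nil measure0.
rewrite !big_cons; case: ifP => // Qi.
apply: (le_trans (measureU2 _ _ _)) => //; first exact: bigsetU_measurable.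
exact: leeD2l.
Qed.

Section bernoulli_tail.
Context {R : realType}.

(** Chernoff's bound for the upper tail of the binomial law, whose probability
    is written as a sum over the outcomes of n trials. *)
Lemma bernoulli_tail (n : nat) (p t : R) : (0 < n)%N -> 0 <= p <= 1 -> 0 <= t ->
  \sum_(c : {ffun 'I_n -> bool} | t < (\sum_i (c i)%:R) / n%:R - p)
     \prod_i (if c i then p else 1 - p) <= expR (- (2 * n%:R * t ^+ 2)).
Proof.
move=> n0 p01 t0; have /andP[p0 p1] := p01.
have n0' : 0 < n%:R :> R by rewrite ltr0n.
(* This is the minimizer of [l ^+ 2 / 8 - l * t]. *)
pose l := 4 * t.
pose F (i : 'I_n) (x : bool) : R := expR (l * (x%:R - p)) * (if x then p else 1 - p).
have F0 i x : 0 <= F i x by rewrite /F mulr_ge0 ?expR_ge0//; case: x; lra.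
have prodF (c : {ffun 'I_n -> bool}) : \prod_i F i (c i) =
    expR (l * (\sum_i (c i)%:R - n%:R * p)) * \prod_i (if c i then p else 1 - p).
  rewrite big_split/= -expR_sum -mulr_sumr; congr (expR (_ * _) * _).
  by rewrite sumrB sumr_const card_ord [n%:R * _]mulr_natl.
have -> : expR (- (2 * n%:R * t ^+ 2)) =
    expR (- (l * n%:R * t)) * \prod_(i < n) expR (l ^+ 2 / 8).
  rewrite -expR_sum -expRD sumr_const card_ord; congr expR.
  by rewrite -mulr_natl /l; field.
apply: (@le_trans _ _ (expR (- (l * n%:R * t)) *
    \sum_(c : {ffun 'I_n -> bool}) \prod_i F i (c i))).
  rewrite big_mkcond/= mulr_sumr; apply: ler_sum => c _.
  have P0 : 0 <= \prod_i (if c i then p else 1 - p).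
    by apply: prodr_ge0 => i _; case: ifP => _; lra.
  case: ifPn => ht; last by rewrite mulr_ge0 ?expR_ge0// prodr_ge0.
  rewrite prodF mulrA -expRD ler_peMl//.
  rewrite -[leLHS]expR0 ler_expR.
  have -> : - (l * n%:R * t) + l * (\sum_i (c i)%:R - n%:R * p) =
      l * (n%:R * ((\sum_i (c i)%:R) / n%:R - p - t)).
    by field; rewrite gt_eqF.
  apply: mulr_ge0; first by rewrite /l; lra.
  by apply: mulr_ge0; [exact: ltW | rewrite subr_ge0 ltW].
rewrite ler_wpM2l ?expR_ge0//.
rewrite -(bigA_distr_bigA F); apply: ler_prod => i _.
rewrite sumr_ge0//= big_bool /F/= sub0r mulrN.
rewrite addrC [X in X + _]mulrC [X in _ + X]mulrC.
by apply: bernoulli_mgf => //; rewrite /l; lra.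
Qed.
End bernoulli_tail.

Section hoeffding.
Context d (T : measurableType d) (R : realType) (P : probability T R) (n : nat).
Implicit Types A : set T.

Definition hits A (s : n.-tuple T) : {ffun 'I_n -> bool} :=
  [ffun i => tnth s i \in A].

Definition frequency (c : {ffun 'I_n -> bool}) : R :=
  (\sum_i (c i)%:R) / n%:R.

Lemma hits_fiber A c : hits A @^-1` [set c] =
  [set s | forall i, (if c i then A else ~` A) (tnth s i)].
Proof.
apply/seteqP; split => s /=.
  move=> <- i; rewrite ffunE; case: ifPn; first by rewrite inE.
  by rewrite notin_setE.
move=> h; apply/ffunP => i; rewrite ffunE; move: (h i).
by case: (c i) => hi; [exact: mem_set | exact: memNset].
Qed.

Lemma measurable_hits A c : measurable A -> measurable (hits A @^-1` [set c]).
Proof.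
move=> mA; rewrite hits_fiber.
rewrite (_ : mkset _ = \bigcap_(i in setT)
    ((@tnth n T)^~ i @^-1` (if c i then A else ~` A))).
  apply: fin_bigcap_measurable => // i _; rewrite -[X in measurable X]setTI.
  by apply: measurable_tnth => //; case: ifP => _ //; exact: measurableC.
by apply/seteqP; split => s /= h i; [move=> _; exact: h | exact: (h i I)].
Qed.

Lemma power_measure_hits A c : measurable A ->
  power_measure P n (hits A @^-1` [set c]) =
  (\prod_i (if c i then fine (P A) else 1 - fine (P A)))%:E.
Proof.
move=> mA; rewrite hits_fiber.
rewrite (@power_measure_box _ _ _ _ _ (fun i => if c i then A else ~` A)); last first.
  by move=> i; case: ifP => _ //; exact: measurableC.
rewrite (big_morph EFin (@EFinM R) erefl).
have fA : P A \is a fin_num by rewrite fin_num_measure.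
apply: eq_bigr => i _; case: ifP => _; first by rewrite fineK.
by apply: (etrans (probability_setC P mA)); rewrite EFinB fineK.
Qed.

(** The pattern of hits determines the frequency, so the event is a finite
    union of fibers whose probabilities are Bernoulli products. *)
Lemma hoeffding_upper A (t : R) : (0 < n)%N -> measurable A -> 0 <= t ->
  (power_measure P n [set s | (t < frequency (hits A s) - fine (P A))%R]
     <= (expR (- (2 * n%:R * t ^+ 2)))%:E)%E.
Proof.
move=> n0 mA t0.
rewrite (finitely_valued_preimageE (hits A)
  (fun c => t < frequency c - fine (P A))).
apply: (le_trans (measure_bigsetU_le _ _ _ _)).
  by move=> c; exact: measurable_hits.
rewrite (eq_bigr _ (fun c _ => power_measure_hits c mA)).
rewrite sumEFin lee_fin; apply: bernoulli_tail => //.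
by rewrite fine_ge0//= -lee_fin fineK ?fin_num_measure// probability_le1.
Qed.

Lemma frequencyC A s : (0 < n)%N ->
  frequency (hits (~` A) s) = 1 - frequency (hits A s).
Proof.
move=> n0; have n0' : n%:R != 0 :> R by rewrite pnatr_eq0 -lt0n.
rewrite /frequency -[X in X - _](divff n0') -mulrBl; congr (_ / _).
rewrite -[in X in X - _](card_ord n) -sumr_const -sumrB.
by apply: eq_bigr => i _; rewrite !ffunE in_setC; case: (_ \in _); rewrite ?subr0 ?subrr.
Qed.

(** The lower tail for [A] is the upper tail for its complement. *)
Lemma hoeffding A (t : R) : (0 < n)%N -> measurable A -> 0 <= t ->
  (power_measure P n [set s | (t < `|frequency (hits A s) - fine (P A)|)%R]
     <= (2 * expR (- (2 * n%:R * t ^+ 2)))%:E)%E.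
Proof.
move=> n0 mA t0.
rewrite (_ : mkset _ = [set s | (t < frequency (hits A s) - fine (P A))%R] `|`
   [set s | (t < frequency (hits (~` A) s) - fine (P (~` A)))%R]); last first.
  have -> : fine (P (~` A)) = 1 - fine (P A).
    by rewrite probability_setC// fineB// fin_num_measure.
  apply/seteqP; split => s /=; rewrite frequencyC// ltr_normr.
    by move=> /orP[h|h]; [left | right]; lra.
  by move=> [h|h]; apply/orP; [left | right]; lra.
apply: (le_trans (measureU2 _ _ _)).
- exact: (measurable_finitely_valued (fun c => measurable_hits c mA)
    (fun c => (t < frequency c - fine (P A))%R)).
- exact: (measurable_finitely_valued
    (fun c => measurable_hits c (measurableC mA))
    (fun c => (t < frequency c - fine (P (~` A)))%R)).
rewrite mulr2n mulrDl mul1r EFinD; apply: leeD; apply: hoeffding_upper => //.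
exact: measurableC.
Qed.
End hoeffding.

(** * Minimum-distance estimates *)

Section scheffe.
Context d (T : measurableType d) (R : realType) (mu : {measure set T -> \bar R}).
Implicit Types (f g p : T -> R) (A : set T).
Local Notation integrable f := (mu.-integrable setT (EFin \o f)).

Definition L1norm f : R := \int[mu]_x `|f x|.

Lemma integrable_sub f g : integrable f -> integrable g ->
  integrable (fun x => f x - g x).
Proof. by move=> fi gi; exact: (integrableB measurableT fi gi). Qed.

Lemma integrable_normr f : integrable f -> integrable (fun x => `|f x|).
Proof. by move=> fi; exact: (integrable_norm fi). Qed.

Lemma Rintegral_setC f A : integrable f -> measurable A ->
  \int[mu]_x f x = \int[mu]_(x in A) f x + \int[mu]_(x in ~` A) f x.
Proof.
move=> fi mA; rewrite -(setUv A) Rintegral_setU ?setUv//.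
  exact: measurableC.
by apply/disj_setPS; rewrite setICr.
Qed.

Lemma integrable_on f A : integrable f -> measurable A ->
  mu.-integrable A (EFin \o f).
Proof. by move=> fi mA; exact: integrableS fi. Qed.

(** As [f - p] integrates to 0, its integrals over [A] and over the complement
    of [A] are opposite, so that each of them carries at most half of the L1
    norm. This factor 2 is what makes the constant 3, rather than 5, in
    [minimum_distance_bound]. *)
Lemma scheffe_bound f p A : integrable f -> integrable p -> measurable A ->
  \int[mu]_x f x = \int[mu]_x p x ->
  2 * `|\int[mu]_(x in A) f x - \int[mu]_(x in A) p x|
    <= L1norm (fun x => f x - p x).
Proof.
move=> fi pi mA fp; have mAC : measurable (~` A) by exact: measurableC.
have gi := integrable_sub fi pi.
rewrite -RintegralB//; [|exact: integrable_on..].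
have /eqP : \int[mu]_x (f x - p x) = 0 by rewrite RintegralB// fp subrr.
rewrite (Rintegral_setC gi mA) addr_eq0 => /eqP h.
rewrite /L1norm (Rintegral_setC (integrable_normr gi) mA) mulr2n mulrDl mul1r.
apply: lerD; last rewrite h normrN.
all: by apply: le_normr_Rintegral => //; exact: integrable_on.
Qed.

Lemma L1norm_triangle f g h : integrable f -> integrable g -> integrable h ->
  L1norm (fun x => f x - h x) <=
  L1norm (fun x => f x - g x) + L1norm (fun x => g x - h x).
Proof.
move=> fi gi hi; rewrite /L1norm -RintegralD//; last 2 first.
- exact/integrable_normr/integrable_sub.
- exact/integrable_normr/integrable_sub.
apply: le_Rintegral => //.
- exact/integrable_normr/integrable_sub.
- exact: (integrableD measurableT (integrable_normr (integrable_sub fi gi))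
    (integrable_normr (integrable_sub gi hi))).
- by move=> x _; rewrite (le_trans _ (ler_normD _ _))// addrA subrK.
Qed.

Lemma L1normC f g : L1norm (fun x => f x - g x) = L1norm (fun x => g x - f x).
Proof. by apply: eq_Rintegral => x _; rewrite distrC. Qed.

End scheffe.

Section minimum_distance.
Context d (T : measurableType d) (R : realType) (mu : {measure set T -> \bar R}).
Local Notation integrable f := (mu.-integrable setT (EFin \o f)).
Context (J : finType) (f : J -> T -> R).
Hypothesis f_int : forall i, integrable (f i).

Definition yatracos (y : J * J) : set T := [set x | f y.2 x < f y.1 x].

Lemma measurable_yatracos y : measurable (yatracos y).
Proof.
have mf i : measurable_fun setT (f i).
  by apply/measurable_EFinP; exact: measurable_int (f_int i).
rewrite -[yatracos y]setTI.
exact: (measurable_fun_ltr (mf _) (mf _) measurableT (Y := [set true])).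
Qed.

Definition discrepancy (nu : J * J -> R) (i : J) : R :=
  \big[Num.max/0]_(y : J * J) `|\int[mu]_(x in yatracos y) f i x - nu y|.

(** The Yatracos sets of both orderings of a pair are needed: [f i - f j] is
    positive on one, negative on the other, and 0 elsewhere. *)
Lemma L1norm_yatracos i j :
  L1norm mu (fun x => f i x - f j x) =
  (\int[mu]_(x in yatracos (i, j)) f i x - \int[mu]_(x in yatracos (i, j)) f j x)
  + (\int[mu]_(x in yatracos (j, i)) f j x - \int[mu]_(x in yatracos (j, i)) f i x).
Proof.
have mY := measurable_yatracos.
have ij := integrable_sub (f_int i) (f_int j).
rewrite /L1norm (Rintegral_setC (integrable_normr ij) (mY (i, j))).
rewrite -!RintegralB//; [|exact: integrable_on..].
congr (_ + _).
  by apply: eq_Rintegral => x; rewrite inE /yatracos/= => h; rewrite gtr0_norm// subr_gt0.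
rewrite Rintegral_mkcond [RHS]Rintegral_mkcond.
apply: eq_Rintegral => x _; rewrite !patchE /yatracos/=.
case: ifPn; rewrite ?notin_setE ?inE/= => ij';
  case: ifPn; rewrite ?notin_setE ?inE/= => ji.
- by rewrite ltr0_norm ?subr_lt0// opprB.
- move/negP: ij'; move/negP: ji; rewrite -!leNgt => ji ij'.
  by have -> : f i x = f j x by [apply/eqP; rewrite eq_le ji ij'|]; rewrite subrr normr0.
- by case: ij' => /=; apply/negP; rewrite -leNgt ltW.
- by [].
Qed.

(** The minimum-distance inequality of Devroye and Lugosi. Here [nu] stands for
    the empirical frequencies, and [i] for the candidate with which the chosen
    one [v] is compared. On a Yatracos set, both [f v] and [f i] differ from
    [nu] by at most the discrepancy of [i], so [f i] and [f v] are at L1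
    distance at most 4 discrepancies of [i]; and this discrepancy is at most
    [t] plus half of the L1 distance between [p] and [f i]. *)
Lemma minimum_distance_bound (p : T -> R) (nu : J * J -> R) (t : R) (v i : J) :
  integrable p -> \int[mu]_x f i x = \int[mu]_x p x ->
  discrepancy nu v <= discrepancy nu i ->
  0 <= t ->
  (forall y, `|nu y - \int[mu]_(x in yatracos y) p x| <= t) ->
  L1norm mu (fun x => p x - f v x) <=
    3 * L1norm mu (fun x => p x - f i x) + 4 * t.
Proof.
move=> pi fpi vi t0 nut.
have disc_ge j y : `|\int[mu]_(x in yatracos y) f j x - nu y| <= discrepancy nu j.
  exact: le_bigmax.
have disci : 2 * discrepancy nu i <= L1norm mu (fun x => p x - f i x) + 2 * t.
  rewrite -ler_pdivlMl//; apply: bigmax_le => [|y _].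
    rewrite mulr_ge0// addr_ge0 ?mulr_ge0//.
    by apply: Rintegral_ge0.
  rewrite ler_pdivlMl// L1normC.
  have := scheffe_bound (f_int i) pi (measurable_yatracos y) fpi.
  have := nut y.
  set b := Rintegral _ _ _; set a := Rintegral _ _ _ => h1 h2.
  have := ler_normD (a - b) (b - nu y); rewrite addrA subrK (distrC b); lra.
have vf : L1norm mu (fun x => f i x - f v x) <= 4 * discrepancy nu i.
  rewrite L1norm_yatracos.
  have := disc_ge i (i, v); have := disc_ge v (i, v).
  have := disc_ge i (v, i); have := disc_ge v (v, i).
  rewrite !ler_norml => /andP[? ?] /andP[? ?] /andP[? ?] /andP[? ?]; lra.
have := L1norm_triangle pi (f_int i) (f_int v).
lra.
Qed.

End minimum_distance.

Section minimum_distance_estimator.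
Context d (T : measurableType d) (R : realType) (mu : {measure set T -> \bar R}).
Local Notation integrable f := (mu.-integrable setT (EFin \o f)).
Context (J : finType) (f : J -> T -> R) (i0 : J) (n : nat).
Hypothesis f_int : forall i, integrable (f i).

Definition yatracos_hits (s : n.-tuple T) : {ffun J * J -> {ffun 'I_n -> bool}} :=
  [ffun y => hits (yatracos f y) s].

(** The choice is made from the pattern of hits and not from the sample, so
    that it factors through a finite type. *)
Definition minimum_distance_index (c : {ffun J * J -> {ffun 'I_n -> bool}}) : J :=
  [arg min_(i < i0) discrepancy mu f (fun y => frequency R (c y)) i]%O.

Definition minimum_distance (s : n.-tuple T) : T -> R :=
  f (minimum_distance_index (yatracos_hits s)).

Lemma measurable_yatracos_hits c : measurable (yatracos_hits @^-1` [set c]).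
Proof.
rewrite (_ : _ @^-1` _ =
    \bigcap_(y in setT) (hits (yatracos f y) @^-1` [set c y])).
  apply: fin_bigcap_measurable => // y _.
  by apply: measurable_hits; exact: (measurable_yatracos f_int).
apply/seteqP; split => s /=; first by move=> <- y _ /=; rewrite ffunE.
by move=> h; apply/ffunP => y; rewrite ffunE; exact: h.
Qed.

Lemma measurable_minimum_distance :
  measurable_fun setT (fun z : n.-tuple T * T => minimum_distance z.1 z.2).
Proof.
apply: (measurable_finite_selection measurable_yatracos_hits
  (g := fun c => f (minimum_distance_index c))) => c.
by apply/measurable_EFinP; exact: measurable_int (f_int _).
Qed.

(** Outside of the union, over the pairs of candidates, of the deviation events
    of the Yatracos sets, [minimum_distance_bound] applies. *)
Lemma minimum_distance_tail (P : probability T R) (p : T -> R) (i : J) (t r : R) :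
  (0 < n)%N -> integrable p ->
  (forall A, measurable A -> fine (P A) = \int[mu]_(x in A) p x) ->
  \int[mu]_x f i x = \int[mu]_x p x -> 0 <= t ->
  3 * L1norm mu (fun x => p x - f i x) + 4 * t <= r ->
  (power_measure P n
     [set s | (r < L1norm mu (fun x => p x - minimum_distance s x))%R]
   <= ((#|J| ^ 2)%:R * (2 * expR (- (2 * n%:R * t ^+ 2))))%:E)%E.
Proof.
move=> n0 pi Pp fpi t0 hr; have mY := measurable_yatracos f_int.
pose dev (y : J * J) := [set s : n.-tuple T |
  (t < `|frequency R (hits (yatracos f y) s) - fine (P (yatracos f y))|)%R].
have mdev y : measurable (dev y).
  have mh c := @measurable_hits _ _ n _ c (mY y).
  exact: (measurable_finitely_valued mh
    (fun c => (t < `|frequency R c - fine (P (yatracos f y))|)%R)).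
apply: (@le_trans _ _ (power_measure P n (\big[setU/set0]_y dev y))).
  apply: le_measure; rewrite ?inE.
  - exact: (measurable_finitely_valued measurable_yatracos_hits
      (fun c => (r < L1norm mu (fun x => p x - f (minimum_distance_index c) x))%R)).
  - exact: bigsetU_measurable.
  move=> s /= rs; rewrite -bigcup_seq.
  apply: contrapT => nodev.
  suff : L1norm mu (fun x => p x - minimum_distance s x) <= r by rewrite leNgt rs.
  apply: le_trans hr.
  apply: (minimum_distance_bound f_int
    (nu := fun y => frequency R (yatracos_hits s y))) => //.
    rewrite /minimum_distance_index.
    by case: arg_minP => // j _; apply.
  move=> y; rewrite -Pp// ffunE leNgt; apply/negP => ty; apply: nodev.
  by exists y => //=; rewrite mem_index_enum.
apply: (le_trans (measure_bigsetU_le (power_measure P n) _ _ mdev)).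
apply: (@le_trans _ _ (\sum_(y : J * J) (2 * expR (- (2 * n%:R * t ^+ 2)))%:E)%E).
  by apply: lee_sum => y _; exact: hoeffding.
by rewrite sumEFin sumr_const card_prod mulnn -[X in (X%:E <= _)%E]mulr_natl.
Qed.

End minimum_distance_estimator.

(** * Histograms as mixtures of cell densities *)

Section product_perturbation.
Context {R : numDomainType}.

(** The factors of the j-th term of the telescoping sum that turns the product
    of [b] into the product of [a] one factor at a time. *)
Definition hybrid_factor d (a b : 'I_d -> R) (j i : 'I_d) : R :=
  if (i < j)%N then a i else if i == j then `|a i - b i| else b i.

Lemma dist_prod_le_hybrid d (a b : 'I_d -> R) :
  (forall i, 0 <= a i) -> (forall i, 0 <= b i) ->
  `|\prod_i a i - \prod_i b i| <= \sum_j \prod_i hybrid_factor a b j i.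
Proof.
elim: d a b => [|d ih] a b a0 b0; first by rewrite !big_ord0 subrr normr0.
rewrite !big_ord_recl.
set A := \prod_(i < d) _; set B := \prod_(i < d) _.
have -> : a ord0 * A - b ord0 * B = (a ord0 - b ord0) * B + a ord0 * (A - B).
  by ring.
apply: le_trans (ler_normD _ _) _; apply: lerD.
  rewrite {1}/hybrid_factor/= normrM ler_wpM2l//.
  by rewrite ger0_norm// prodr_ge0.
rewrite normrM ger0_norm//.
apply: le_trans (ler_wpM2l (a0 _) (ih _ _ _ _)) _ => //.
rewrite mulr_sumr; apply: ler_sum => j _.
by rewrite big_ord_recl {2}/hybrid_factor/=; apply: ler_wpM2l.
Qed.

(** Product laws are at most as far apart as the sum of the distances of their
    factors: summed over all outcomes, a hybrid product becomes a product of
    sums, all of which are 1 except the j-th. *)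
Lemma sum_dist_prod_le d (J : finType) (a b : 'I_d -> J -> R) :
  (forall i l, 0 <= a i l) -> (forall i, \sum_l a i l = 1) ->
  (forall i l, 0 <= b i l) -> (forall i, \sum_l b i l = 1) ->
  \sum_(c : {ffun 'I_d -> J}) `|\prod_i a i (c i) - \prod_i b i (c i)|
    <= \sum_i \sum_l `|a i l - b i l|.
Proof.
move=> a0 a1 b0 b1.
apply: (@le_trans _ _ (\sum_(c : {ffun 'I_d -> J}) \sum_j \prod_i
    hybrid_factor (fun i => a i (c i)) (fun i => b i (c i)) j i)).
  by apply: ler_sum => c _; apply: dist_prod_le_hybrid.
rewrite exchange_big/=; apply: ler_sum => j _.
pose F (i : 'I_d) l :=
  if (i < j)%N then a i l else if i == j then `|a i l - b i l| else b i l.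
rewrite -(bigA_distr_bigA F) (bigD1 j)//= [X in _ * X]big1 ?mulr1.
  by under eq_bigr do rewrite /F ltnn eqxx.
by move=> i /negbTE ij; rewrite /F ij; case: (i < j)%N.
Qed.
End product_perturbation.

Section histograms.
Context {R : realType} (d b k : nat).

(** The mixing weights and all the bin masses are kept in a single vector, so
    that compactness and quantization can be treated coordinatewise. *)
Definition hist_index : finType := ('I_k + 'I_k * 'I_d * 'I_b)%type.
Implicit Types (th : hist_index -> R) (c : {ffun 'I_d -> 'I_b}).

Definition weight th (i : 'I_k) : R := th (inl i).
Definition bin_mass th i j (l : 'I_b) : R := th (inr (i, j, l)).

Definition hist_params : set (hist_index -> R) :=
  [set th | simplex (weight th) /\ forall i j, simplex (bin_mass th i j)].

Definition cell_mass th c : R := \sum_i weight th i * \prod_j bin_mass th i j (c j).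

Definition cell c : set (eucl R d) :=
  [set x | forall j, `[(c j)%:R / b%:R, (c j).+1%:R / b%:R[%classic (tnth x j)].

Definition cell_density c (x : eucl R d) : R := b%:R ^+ d * \1_(cell c) x.

Definition histogram th (x : eucl R d) : R := \sum_c cell_mass th c * cell_density c x.

Lemma simplex_le1 m (w : 'I_m -> R) i : simplex w -> 0 <= w i <= 1.
Proof.
move=> [w0 w1]; rewrite w0 -w1 (bigD1 i)//= lerDl.
by rewrite sumr_ge0.
Qed.

Lemma hist_params_le1 th i : hist_params th -> 0 <= th i <= 1.
Proof.
move=> [wP bP]; case: i => [i|[[i j] l]]; first exact: (simplex_le1 i wP).
exact: (simplex_le1 l (bP i j)).
Qed.

Lemma hist1P (f : R -> R) : hist1 b f <->
  exists2 v : 'I_b -> R, simplex v & f = fun x => \sum_l v l * bin l x.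
Proof.
split=> [[m [w [g [[w0 w1] gP ->]]]]|[v vP ->]]; last first.
  by exists b, v, (@bin R b); split => // i; exists i.
have exs i : exists l : 'I_b, bin l = g i by have [l _ lg] := gP i; exists l.
have [s sP] := choice exs.
exists (fun l => \sum_(i | s i == l) w i).
  split; first by move=> l; exact: sumr_ge0.
  by rewrite -w1 (partition_big s xpredT).
apply/funext => x; rewrite (partition_big s xpredT)//=; apply: eq_bigr => l _.
by rewrite mulr_suml; apply: eq_bigr => i /eqP <-; rewrite sP.
Qed.

Lemma prod_bin c (x : eucl R d) : \prod_j bin (c j) (tnth x j) = cell_density c x.
Proof.
rewrite /cell_density /bin big_split/= prodr_const card_ord; congr (_ * _).
have [cx|cx] := pselect (cell c x).
  by rewrite indicE mem_set// big1// => j _; rewrite indicE mem_set//; exact: cx.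
rewrite indicE memNset//.
have [j cxj] : exists j, ~ `[(c j)%:R / b%:R, (c j).+1%:R / b%:R[%classic (tnth x j).
  exact/existsNP.
by rewrite (bigD1 j)//= indicE memNset ?mul0r.
Qed.

(** Distributing the product over the coordinates gives one term for each choice
    of a bin in every coordinate, that is, for each cell. *)
Lemma mvhistP (f : eucl R d -> R) :
  mvhist R d b k f <-> exists2 th, hist_params th & f = histogram th.
Proof.
have histE th : (fun x => \sum_i weight th i *
    \prod_j \sum_l bin_mass th i j l * bin l (tnth x j)) = histogram th.
  apply/funext => x; rewrite /histogram /cell_mass.
  under [RHS]eq_bigr do rewrite mulr_suml.
  rewrite exchange_big/=; apply: eq_bigr => i _.
  rewrite (bigA_distr_bigA (fun j l => bin_mass th i j l * bin l (tnth x j))).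
  rewrite mulr_sumr; apply: eq_bigr => c _.
  by rewrite big_split/= prod_bin mulrA.
split=> [[w [p [wP pP ->]]]|[th [wP bP] ->]]; last first.
  exists (weight th), (fun i j x => \sum_l bin_mass th i j l * bin l x).
  split=> // i j; apply/hist1P.
  by exists (bin_mass th i j).
have exv (ij : 'I_k * 'I_d) : exists v : 'I_b -> R,
    simplex v /\ p ij.1 ij.2 = fun x => \sum_l v l * bin l x.
  by have /hist1P[v vP pv] := pP ij.1 ij.2; exists v.
have [v vP] := choice exv.
pose th (s : hist_index) := match s with inl i => w i | inr u => v u.1 u.2 end.
exists th; first by split => // i j; exact: (vP (i, j)).1.
rewrite -histE; apply/funext => x; apply: eq_bigr => i _; congr (_ * _).
by apply: eq_bigr => j _; rewrite (vP (i, j)).2.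
Qed.

Lemma sum_prod_bin_mass th i : hist_params th ->
  \sum_(c : {ffun 'I_d -> 'I_b}) \prod_j bin_mass th i j (c j) = 1.
Proof.
move=> [_ bP]; rewrite -(bigA_distr_bigA (bin_mass th i)) big1// => j _.
exact: (bP i j).2.
Qed.

Lemma sum_cell_mass th : hist_params th -> \sum_c cell_mass th c = 1.
Proof.
move=> thP; rewrite exchange_big/= -[RHS]thP.1.2; apply: eq_bigr => i _.
by rewrite -mulr_sumr sum_prod_bin_mass// mulr1.
Qed.

(** Each of the k weights contributes its own error. The bin masses contribute,
    for each component of the mixture, the errors of its d factors, and the
    components are averaged: whence d b and not k d b. *)
Lemma cell_mass_lipschitz th th' (e : R) : hist_params th -> hist_params th' ->
  (forall i, `|th i - th' i| <= e) ->
  \sum_c `|cell_mass th c - cell_mass th' c| <= (k + d * b)%:R * e.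
Proof.
move=> thP thP' the.
have [[w0 w1] bP] := thP; have [[w0' w1'] bP'] := thP'.
pose D i c := `|\prod_j bin_mass th i j (c j) - \prod_j bin_mass th' i j (c j)|.
apply: (@le_trans _ _ (\sum_c \sum_i (weight th i * D i c +
    `|weight th i - weight th' i| * \prod_j bin_mass th' i j (c j)))).
  apply: ler_sum => c _; rewrite /cell_mass -sumrB.
  apply: le_trans (ler_norm_sum _ _ _) _; apply: ler_sum => i _.
  set A := \prod_j _; set B := \prod_j _.
  have -> : weight th i * A - weight th' i * B =
      weight th i * (A - B) + (weight th i - weight th' i) * B by ring.
  apply: le_trans (ler_normD _ _) _; rewrite !normrM.
  rewrite (ger0_norm (w0 i)) (ger0_norm (_ : 0 <= B))// prodr_ge0// => j _.
  exact: (bP' i j).1.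
rewrite exchange_big/=.
under eq_bigr do rewrite big_split/= -!mulr_sumr sum_prod_bin_mass// mulr1.
rewrite big_split/= natrD mulrDl addrC; apply: lerD.
  apply: (@le_trans _ _ (\sum_(i < k) e)); first by apply: ler_sum => i _; exact: the.
  by rewrite sumr_const card_ord mulr_natl.
have -> : (d * b)%:R * e = \sum_i weight th i * ((d * b)%:R * e).
  by rewrite -mulr_suml w1 mul1r.
apply: ler_sum => i _; apply: ler_wpM2l => //.
apply: le_trans (sum_dist_prod_le _ _ _ _) _.
- by move=> j; exact: (bP i j).1.
- by move=> j; exact: (bP i j).2.
- by move=> j; exact: (bP' i j).1.
- by move=> j; exact: (bP' i j).2.
apply: (@le_trans _ _ (\sum_(j < d) \sum_(l < b) e)).
  by apply: ler_sum => j _; apply: ler_sum => l _; exact: the.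
by rewrite !sumr_const !card_ord -mulrnA mulnC mulr_natl.
Qed.

End histograms.

(** * The L1 geometry of histograms and the best approximation *)

Section finite_combination.
Context d (T : measurableType d) (R : realType) (mu : {measure set T -> \bar R}).
Context (I : finType) (F : I -> T -> R).
Hypothesis F_int : forall i, mu.-integrable setT (EFin \o F i).

Lemma integrable_finsum (a : I -> R) :
  mu.-integrable setT (EFin \o (fun x => \sum_i a i * F i x)).
Proof.
rewrite (_ : _ \o _ = fun x => (\sum_i (a i)%:E * (F i x)%:E)%E).
  by apply: integrable_sum => // i _; exact: (integrableZl measurableT (a i) (F_int i)).
by apply/funext => x; rewrite /= -sumEFin.
Qed.

Lemma Rintegral_finsum (a : I -> R) :
  \int[mu]_x (\sum_i a i * F i x) = \sum_i a i * \int[mu]_x F i x.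
Proof.
have aF_int i : mu.-integrable setT (fun x => (a i * F i x)%:E).
  exact: (integrableZl measurableT (a i) (F_int i)).
rewrite /Rintegral; under eq_integral do rewrite -sumEFin.
rewrite (integral_sum measurableT aF_int) -sum_fine; last first.
  by move=> i _; exact: (integrable_fin_num measurableT).
by apply: eq_bigr => i _; rewrite -[RHS](RintegralZl _ measurableT).
Qed.

Lemma L1norm_finsum_le (a : I -> R) : (forall i x, 0 <= F i x) ->
  L1norm mu (fun x => \sum_i a i * F i x) <= \sum_i `|a i| * \int[mu]_x F i x.
Proof.
move=> F0; rewrite -Rintegral_finsum; apply: le_Rintegral => //.
- exact/integrable_normr/integrable_finsum.
- exact: integrable_finsum.
move=> x _; apply: le_trans (ler_norm_sum _ _ _) _; apply: ler_sum => i _.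
by rewrite normrM (ger0_norm (F0 _ _)).
Qed.
End finite_combination.

(** On a space without a chosen metric, a modulus [G] that is continuous in its
    second variable replaces a Lipschitz condition. *)
Lemma continuous_modulus (R : realType) (X : topologicalType) (f : X -> R)
    (G : X -> X -> R) : (forall x, continuous (G x)) -> (forall x, G x x = 0) ->
  (forall x y, `|f x - f y| <= G x y) -> continuous f.
Proof.
move=> Gc G0 fG x; apply/(@cvgrPdist_lt R R^o) => e e0.
have : \forall y \near x, G x y < e.
  by apply: (cvgr_lt (G x x)); [exact: Gc | rewrite G0].
by apply: filterS => y; exact: le_lt_trans.
Qed.

Section histogram_integral.
Context {R : realType} (d b k : nat) (b_gt0 : (0 < b)%N).
Implicit Types (th : hist_index d b k -> R) (c : {ffun 'I_d -> 'I_b}).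
Local Notation mu := (lebesgue_eucl R d).
Local Notation integrable f := (mu.-integrable setT (EFin \o f)).

Lemma measurable_cell c : measurable (cell c : set (eucl R d)).
Proof.
rewrite (_ : cell c = \bigcap_(j in setT) ((@tnth d (measurableTypeR R))^~ j
    @^-1` `[(c j)%:R / b%:R, (c j).+1%:R / b%:R[%classic)).
  apply: fin_bigcap_measurable => // j _; rewrite -[X in measurable X]setTI.
  by apply: measurable_tnth => //; exact: measurable_itv.
by apply/seteqP; split => x /= h j; [move=> _; exact: h | exact: (h j I)].
Qed.

Lemma lebesgue_cell c : mu (cell c) = (b%:R^-1 ^+ d)%:E.
Proof.
rewrite /lebesgue_eucl /cell (@power_measure_box _ _ _ _ _ (fun j =>
  `[(c j)%:R / b%:R, (c j).+1%:R / b%:R[%classic : set (measurableTypeR R))); last first.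
  by move=> j; exact: measurable_itv.
have -> : b%:R^-1 ^+ d = \prod_(j < d) b%:R^-1 :> R by rewrite prodr_const card_ord.
rewrite (big_morph EFin (@EFinM R) erefl); apply: eq_bigr => j _.
have b0 : 0 < b%:R :> R by rewrite ltr0n.
apply: (etrans (lebesgue_measure_itv _)).
rewrite /= lte_fin ltr_pM2r ?invr_gt0// ltr_nat ltnSn.
by rewrite -EFinD -mulrBl -natr1 addrAC subrr add0r mul1r.
Qed.

Lemma cell_density_ge0 c (x : eucl R d) : 0 <= cell_density c x.
Proof. by rewrite mulr_ge0// exprn_ge0. Qed.

Lemma integrable_indic_cell c : integrable (\1_(cell c) : eucl R d -> R).
Proof.
have mc := measurable_cell c.
apply/integrableP; split; first by apply/measurable_EFinP; exact: measurable_indic.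
rewrite (eq_integral (fun x => (\1_(cell c) x)%:E)); last first.
  by move=> x _; rewrite /= ger0_norm// indicE.
have muc : (mu (cell c) < +oo)%E by rewrite lebesgue_cell ltry.
by rewrite integral_indic// setIT.
Qed.

Lemma integrable_cell_density c : integrable (@cell_density R d b c).
Proof.
exact: (integrableZl measurableT (b%:R ^+ d) (integrable_indic_cell c)).
Qed.

Lemma Rintegral_cell_density c : \int[mu]_x cell_density c x = 1.
Proof.
rewrite RintegralZl//; last exact: integrable_indic_cell.
have mc := measurable_cell c.
have muc : fine (mu (cell c)) = b%:R^-1 ^+ d by rewrite lebesgue_cell.
rewrite /Rintegral integral_indic// setIT.
by rewrite [X in _ * X]muc -exprMn divff ?expr1n// pnatr_eq0 -lt0n.
Qed.

Lemma integrable_histogram th : integrable (histogram th).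
Proof. exact/integrable_finsum/integrable_cell_density. Qed.

Lemma Rintegral_histogram th : hist_params th -> \int[mu]_x histogram th x = 1.
Proof.
move=> thP; rewrite Rintegral_finsum; last exact: integrable_cell_density.
rewrite -[RHS](sum_cell_mass thP); apply: eq_bigr => c _.
by rewrite Rintegral_cell_density mulr1.
Qed.

Lemma L1norm_histogram_le th th' :
  L1norm mu (fun x => histogram th x - histogram th' x) <=
  \sum_c `|cell_mass th c - cell_mass th' c|.
Proof.
rewrite (_ : (fun x => _) = fun x => \sum_c (cell_mass th c - cell_mass th' c) *
    cell_density c x); last first.
  by apply/funext => x; rewrite -sumrB; apply: eq_bigr => c _; rewrite mulrBl.
apply: (le_trans (L1norm_finsum_le _ _ _)).
- exact: integrable_cell_density.
- exact: cell_density_ge0.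
by apply: ler_sum => c _; rewrite Rintegral_cell_density mulr1.
Qed.

Lemma L1norm_histogram_lipschitz (p : eucl R d -> R) th th' : integrable p ->
  `|L1norm mu (fun x => p x - histogram th x) -
    L1norm mu (fun x => p x - histogram th' x)| <=
  \sum_c `|cell_mass th c - cell_mass th' c|.
Proof.
move=> p_int; have hi := integrable_histogram.
have h1 := L1norm_triangle p_int (hi th) (hi th').
have h2 := L1norm_triangle p_int (hi th') (hi th).
have h3 := L1norm_histogram_le th th'.
have h4 := L1normC mu (histogram th) (histogram th').
rewrite ler_distl; apply/andP; split; lra.
Qed.

(* From here on, parameter vectors carry the product topology. *)
Import ArrowAsProduct.

Lemma coord_continuous (I : finType) (i : I) :
  continuous (fun th : I -> R => th i).
Proof. exact: (@proj_continuous I (fun=> R) i). Qed.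

Lemma cell_mass_continuous c : continuous (fun th => cell_mass th c).
Proof.
rewrite /cell_mass; apply: continuous_big; first exact: add_continuous.
move=> i _.
have wc : continuous (fun th : hist_index d b k -> R => weight th i).
  exact: coord_continuous.
have pc : continuous (fun th : hist_index d b k -> R =>
    \prod_j bin_mass th i j (c j)).
  apply: continuous_big; first exact: mul_continuous.
  by move=> j _; exact: coord_continuous.
by move=> th; exact: (continuousM (wc th) (pc th)).
Qed.

Lemma cell_mass_dist_continuous th :
  continuous (fun th' => \sum_c `|cell_mass th c - cell_mass th' c|).
Proof.
apply: continuous_big; first exact: add_continuous.
move=> c _ th'.
have dist_continuous : continuous (fun x : R => `|cell_mass th c - x|).
  by move=> x; apply: cvg_norm; apply: cvgB; [exact: cvg_cst | exact: cvg_id].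
exact: (continuous_comp (@cell_mass_continuous c th') (dist_continuous _)).
Qed.

Lemma closed_simplex (J : finType) m (u : 'I_m -> J) :
  closed [set th : J -> R | simplex (th \o u)].
Proof.
rewrite (_ : mkset _ = \bigcap_(i in setT)
     ((fun th : J -> R => th (u i)) @^-1` [set x | 0 <= x])
   `&` ((fun th : J -> R => \sum_i th (u i)) @^-1` [set x | x = 1])).
  apply: closedI.
    apply: closed_bigI => i _.
    by apply: (continuous_closedP _).1; [exact: coord_continuous | exact: closed_ge].
  apply: (continuous_closedP _).1; last exact: closed_eq.
  apply: continuous_big; first exact: add_continuous.
  by move=> i _; exact: coord_continuous.
apply/seteqP; split => th /= [h0 h1]; split => // i; first by move=> _; exact: h0.
exact: (h0 i I).
Qed.

Lemma hist_params_compact : compact (@hist_params R d b k).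
Proof.
apply: (@subclosed_compact _ _
  [set th : hist_index d b k -> R | forall i, `[0, 1]%classic (th i)]).
- rewrite (_ : @hist_params R d b k =
      [set th : hist_index d b k -> R | simplex (th \o inl)] `&`
      \bigcap_(ij in setT) [set th : hist_index d b k -> R |
        simplex (th \o (fun l => inr (ij, l)))]).
    apply: closedI; first exact: closed_simplex.
    by apply: closed_bigI => ij _; exact: closed_simplex.
  apply/seteqP; split => th /= [h0 h1]; split => //; first by move=> [i j] _; exact: h1.
  by move=> i j; exact: (h1 (i, j) I).
- by apply: (@tychonoff _ (fun=> R) (fun=> `[0, 1]%classic)) => _; exact: segment_compact.
by move=> th thP i /=; rewrite in_itv/=; exact: hist_params_le1.
Qed.

(** A continuous function attains its minimum on the compact set of
    parameters. *)
Lemma best_histogram (p : eucl R d -> R) : integrable p ->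
  (exists th : hist_index d b k -> R, hist_params th) ->
  exists2 th : hist_index d b k -> R, hist_params th &
    forall th', hist_params th' -> L1norm mu (fun x => p x - histogram th x) <=
      L1norm mu (fun x => p x - histogram th' x).
Proof.
move=> p_int nonempty.
have Lc : continuous (fun th : hist_index d b k -> R =>
    L1norm mu (fun x => p x - histogram th x)).
  apply: (continuous_modulus cell_mass_dist_continuous) => [th|th th'].
    by rewrite big1 => [|c _] //; rewrite subrr normr0.
  exact: L1norm_histogram_lipschitz.
have [th thP thmin] := compact_EVT_min nonempty hist_params_compact
  (continuous_subspaceT Lc).
exists th; first by rewrite inE in thP.
by move=> th' th'P; apply: thmin; rewrite inE.
Qed.

End histogram_integral.

(** * A finite net of histograms *)

Section quantization.
Context {R : realType} (d b k N : nat).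
Hypothesis N_gt0 : (0 < N)%N.
Implicit Types th : hist_index d b k -> R.

(** On parameter vectors, whose coordinates lie in [0, 1], the truncations lie
    in {0, ..., N} and [inord] keeps them. *)
Definition grid_cell th : {ffun hist_index d b k -> 'I_N.+1} :=
  [ffun i => inord (Num.truncn (N%:R * th i))].

Lemma grid_cell_close th th' : hist_params th -> hist_params th' ->
  grid_cell th = grid_cell th' -> forall i, `|th i - th' i| <= N%:R^-1.
Proof.
move=> thP thP' /ffunP eqc i; have N0 : 0 < N%:R :> R by rewrite ltr0n.
have bnd (u : hist_index d b k -> R) : hist_params u ->
    0 <= N%:R * u i /\ (Num.truncn (N%:R * u i) < N.+1)%N.
  move=> uP; have /andP[u0 u1] := hist_params_le1 i uP.
  split; first by rewrite mulr_ge0// ltW.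
  rewrite ltnS -(ler_nat R).
  apply: (@le_trans _ _ (N%:R * u i)).
    by have /andP[] := truncn_itv (mulr_ge0 (ltW N0) u0).
  by rewrite ler_piMr// ltW.
have [g0 gN] := bnd _ thP; have [g0' gN'] := bnd _ thP'.
have := eqc i; rewrite !ffunE => /(congr1 (@nat_of_ord _)); rewrite !inordK// => e.
have /andP[l1 l2] := truncn_itv g0; have /andP[l3 l4] := truncn_itv g0'.
rewrite -e -natr1 in l3 l4; rewrite -natr1 in l2.
rewrite -(ler_pM2l N0) divff ?gt_eqF// -{1}(gtr0_norm N0) -normrM mulrBr.
rewrite ler_norml; apply/andP; split; lra.
Qed.

Lemma hist_params_nonempty : (0 < b)%N -> (0 < k)%N ->
  exists th, hist_params th.
Proof.
move=> b0 k0.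
have dirac m (m0 : (0 < m)%N) : simplex (fun i : 'I_m => (i == Ordinal m0)%:R : R).
  split => [i|]; first exact: ler0n.
  rewrite (bigD1 (Ordinal m0))// eqxx big1 => [|i /negbTE ->//].
  by rewrite /= addr0.
exists (fun s => match s with
  | inl i => (i == Ordinal k0)%:R | inr u => (u.2 == Ordinal b0)%:R end).
by split => [|i j]; exact: dirac.
Qed.

(** The net consists of one parameter vector chosen in each nonempty cell of the
    grid. Unlike a rounded vector, a chosen one satisfies the simplex
    constraints. *)
Lemma histogram_net : (0 < b)%N -> (0 < k)%N ->
  exists rep : {ffun hist_index d b k -> 'I_N.+1} -> hist_index d b k -> R,
    (forall a, hist_params (rep a)) /\
    forall th, hist_params th ->
      exists a, \sum_c `|cell_mass th c - cell_mass (rep a) c|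
        <= (k + d * b)%:R / N%:R.
Proof.
move=> b0 k0; have [th0 th0P] := hist_params_nonempty b0 k0.
(* Empty cells are represented by an arbitrary parameter vector. *)
have ex a : exists r, hist_params r /\
    forall th, hist_params th -> grid_cell th = a -> grid_cell r = a.
  have [[th [thP tha]]|none] := pselect (exists th, hist_params th /\ grid_cell th = a).
    by exists th.
  by exists th0; split => // th thP tha; case: none; exists th.
have [rep repP] := choice ex; exists rep; split => [a|th thP].
  exact: (repP a).1.
exists (grid_cell th); apply: cell_mass_lipschitz => //; first exact: (repP _).1.
apply: grid_cell_close => //; first exact: (repP _).1.
by rewrite ((repP (grid_cell th)).2 th).
Qed.

Lemma card_grid : #|{ffun hist_index d b k -> 'I_N.+1}| = (N.+1 ^ (k + k * d * b))%N.
Proof. by rewrite card_ffun card_ord card_sum !card_prod !card_ord. Qed.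

End quantization.

(** * Densities and the rate of convergence *)

Section densities.
Context {R : realType} (d : nat).
Local Notation mu := (lebesgue_eucl R d).

Lemma integrable_density (p : density R d) : mu.-integrable setT (EFin \o p).
Proof.
apply/integrableP; split.
  by apply/measurable_EFinP; exact: measurable_density.
rewrite (eq_integral (fun x => (p x)%:E)); last first.
  by move=> x _ /=; rewrite ger0_norm// density_ge0.
by rewrite integral_density ltry.
Qed.

Lemma L1distE (p q : eucl R d -> R) :
  mu.-integrable setT (EFin \o p) -> mu.-integrable setT (EFin \o q) ->
  L1dist p q = (L1norm mu (fun x => p x - q x))%:E.
Proof.
move=> pi qi; have := integrable_normr (integrable_sub pi qi).
move=> /(integrable_fin_num measurableT) fin.
by rewrite /L1dist Lnorm1 /L1norm /Rintegral fineK.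
Qed.

(** This rules out the default value: a minimum that is attained is unique. *)
Lemma minimumE (A : set (\bar R)) (m : \bar R) :
  A m -> lbound A m -> minimum A = m.
Proof.
move=> Am lbm; rewrite /minimum; case: xgetP => [x _ [Ax lbx]|/(_ m) []//].
by apply/eqP; rewrite eq_le lbx//= lbm.
Qed.

End densities.

Section rates.
Context {R : realType}.

Lemma ln_ge1Bv (x : R) : 0 < x -> 1 - x^-1 <= ln x.
Proof.
move=> x0; have v0 : 0 < x^-1 by rewrite invr_gt0.
have : -1 < x^-1 - 1 by lra.
move=> /le_ln1Dx; rewrite [1 + _]addrC subrK lnV ?posrE//; lra.
Qed.

Lemma sqrtrD_le (x y : R) : 0 <= x -> 0 <= y ->
  Num.sqrt (x + y) <= Num.sqrt x + Num.sqrt y.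
Proof.
move=> x0 y0; rewrite -(ler_pXn2r (ltn0Sn 1)) ?nnegrE ?addr_ge0 ?sqrtr_ge0//.
rewrite sqr_sqrtr ?addr_ge0// sqrrD !sqr_sqrtr//.
have : 0 <= Num.sqrt x * Num.sqrt y by rewrite mulr_ge0// sqrtr_ge0.
rewrite mulr2n; lra.
Qed.

(** Let L = 2 b d k ln (4 b d k n). As k + k d b <= 2 b d k, the net has
    ln M <= L, so the deviation term is at most 4 sqrt (L / n) plus four times
    the term in delta. As k + d b <= 2 b d k and L >= 1, the net is dense up to
    1 / n <= sqrt (L / n). Altogether the coefficient of sqrt (L / n) is
    4 + 3 = 7, and that of the term in delta is 4 <= 7. *)
Lemma rate_bound (d b k n K M : nat) (delta : R) :
  (0 < d)%N -> (0 < b)%N -> (0 < k)%N -> (0 < n)%N -> 0 < delta -> delta <= 1 ->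
  K = (4 * b * d * k * n)%N -> M = (K ^ (k + k * d * b))%N ->
  3 * ((k + d * b)%:R / K.-1%:R)
    + 4 * Num.sqrt (ln (3 * (M ^ 2)%:R / delta) / (2 * n%:R))
  <= 7 * Num.sqrt (2 * b%:R * d%:R * k%:R
                    * ln (4 * b%:R * d%:R * k%:R * n%:R) / n%:R)
     + 7 * Num.sqrt (ln (3 / delta) / (2 * n%:R)).
Proof.
move=> d0 b0 k0 n0 delta0 delta1 KE ME.
have n0' : 0 < n%:R :> R by rewrite ltr0n.
have kE : (k <= b * d * k)%N by rewrite leq_pmull// muln_gt0 b0.
have dbE : (d * b <= b * d * k)%N by rewrite (mulnC d) leq_pmulr.
have bdk0 : (0 < b * d * k)%N by rewrite !muln_gt0 b0 d0.
have KE' : K = (4 * (b * d * k) * n)%N by rewrite KE !mulnA.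
have K4 : (4 <= K)%N by rewrite KE' -mulnA leq_pmulr// muln_gt0 bdk0.
have K_gt0 : (0 < K)%N by rewrite (leq_trans _ K4).
have lnK_ge : 3 / 4 <= ln K%:R :> R.
  apply: (@le_trans _ _ (1 - K%:R^-1)); last by rewrite ln_ge1Bv ?ltr0n.
  have : K%:R^-1 <= 4^-1 :> R by rewrite lef_pV2 ?posrE ?ltr0n// ler_nat.
  lra.
have -> : 4 * b%:R * d%:R * k%:R * n%:R = K%:R :> R by rewrite KE !natrM.
have -> : 2 * b%:R * d%:R * k%:R = (2 * (b * d * k))%:R :> R by rewrite !natrM !mulrA.
set L := (2 * (b * d * k))%:R * ln K%:R.
have L1 : 1 <= L.
  have : 2 <= (2 * (b * d * k))%:R :> R by rewrite ler_nat leq_pmulr.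
  rewrite /L; nra.
have M0 : 0 < M%:R :> R by rewrite ltr0n ME expn_gt0 K_gt0.
have lnML : ln M%:R <= L.
  rewrite ME natrX lnXn ?ltr0n// -[leLHS]mulr_natl /L ler_wpM2r//; first by lra.
  rewrite ler_nat mul2n -addnn leq_add//.
  by rewrite [(k * d * b)%N]mulnC mulnA [(b * k * d)%N]mulnAC.
have lnM0 : 0 <= ln M%:R :> R.
  by apply: ln_ge0; rewrite ler1n ME expn_gt0 K_gt0.
have lnd0 : 0 <= ln (3 / delta).
  by apply: ln_ge0; rewrite ler_pdivlMr// mul1r; lra.
have net_nat : (n * (k + d * b) <= K.-1)%N.
  rewrite -ltnS prednK// KE'.
  apply: (@leq_ltn_trans (2 * (b * d * k) * n)).
    by rewrite mulnC leq_mul2r mul2n -addnn leq_add ?orbT.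
  by rewrite -!(mulnA _ (b * d * k)%N) ltn_mul2r muln_gt0 bdk0 n0.
have K1 : 0 < K.-1%:R :> R by rewrite ltr0n -ltnS prednK// (leq_trans _ K4).
have net : (k + d * b)%:R / K.-1%:R <= Num.sqrt (L / n%:R).
  apply: (@le_trans _ _ n%:R^-1).
    by rewrite (ler_pdivrMr _ _ K1) (ler_pdivlMl _ _ n0') -natrM ler_nat.
  rewrite -(ler_pXn2r (ltn0Sn 1)) ?nnegrE ?sqrtr_ge0 ?invr_ge0 ?ler0n//.
  rewrite sqr_sqrtr; last by rewrite divr_ge0 ?ler0n//; lra.
  rewrite expr2 ler_wpM2r ?invr_ge0 ?ler0n//.
  by rewrite (le_trans _ L1)// invf_le1// ler1n.
have dev : Num.sqrt (ln (3 * (M ^ 2)%:R / delta) / (2 * n%:R)) <=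
    Num.sqrt (L / n%:R) + Num.sqrt (ln (3 / delta) / (2 * n%:R)).
  have -> : ln (3 * (M ^ 2)%:R / delta) / (2 * n%:R) =
      ln M%:R / n%:R + ln (3 / delta) / (2 * n%:R).
    have -> : 3 * (M ^ 2)%:R / delta = M%:R ^+ 2 * (3 / delta) by rewrite natrX; ring.
    rewrite lnM ?posrE ?exprn_gt0 ?divr_gt0// lnXn// -mulr_natl.
    by field; rewrite gt_eqF.
  apply: (le_trans (sqrtrD_le _ _)).
  - by rewrite divr_ge0 ?ler0n.
  - by rewrite divr_ge0// mulr_ge0 ?ler0n.
  rewrite lerD2r ler_wsqrtr// ler_wpM2r// ?invr_ge0 ?ler0n//.
have := sqrtr_ge0 (ln (3 / delta) / (2 * n%:R)); lra.
Qed.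

End rates.

Theorem proposition2p1 (R : realType) (d b k n : nat) (delta : R)
    (d_gt0 : (0 < d)%N) (b_gt0 : (0 < b)%N) (k_gt0 : (0 < k)%N)
    (n_gt0 : (0 < n)%N) (delta_gt0 : 0 < delta) (delta_le1 : delta <= 1) :
  exists V : n.-tuple (eucl R d) -> eucl R d -> R,
    is_estimator b k V /\
    (ereal_sup (range (fun p : density R d =>
       sample_law p n
         [set s | 3%:E * minimum [set L1dist p q | q in mvhist R d b k]
                  + (7 * Num.sqrt (2 * b%:R * d%:R * k%:R
                                   * ln (4 * b%:R * d%:R * k%:R * n%:R)
                                   / n%:R))%:E
                  + (7 * Num.sqrt (ln (3 / delta) / (2 * n%:R)))%:E
                  < L1dist p (V s)]))
     < delta%:E)%E.
Proof.
pose K := (4 * b * d * k * n)%N; pose N := K.-1.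
have K4 : (4 <= K)%N by rewrite /K -!mulnA leq_pmulr// !muln_gt0 b_gt0 d_gt0 k_gt0.
have K_gt0 : (0 < K)%N by rewrite (leq_trans _ K4).
have NK : N.+1 = K by rewrite prednK.
have N_gt0 : (0 < N)%N by rewrite -ltnS NK (leq_trans _ K4).
have [rep [repP rep_net]] := @histogram_net R d b k N N_gt0 b_gt0 k_gt0.
pose f a := histogram (rep a).
have f_int a : (lebesgue_eucl R d).-integrable setT (EFin \o f a).
  exact: integrable_histogram.
pose V := minimum_distance (lebesgue_eucl R d) f [ffun=> ord0] (n := n).
pose M := #|{ffun hist_index d b k -> 'I_N.+1}|.
have ME : M = (K ^ (k + k * d * b))%N by rewrite /M card_grid NK.
have M_gt0 : 0 < M%:R :> R by rewrite ltr0n ME expn_gt0 K_gt0.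
exists V; split.
  split=> [s|]; last exact: measurable_minimum_distance.
  apply/mvhistP; rewrite /V /minimum_distance.
  by exists (rep (minimum_distance_index (lebesgue_eucl R d) f [ffun=> ord0]
    (yatracos_hits f s))).
pose t := Num.sqrt (ln (3 * (M ^ 2)%:R / delta) / (2 * n%:R)).
have n_gt0' : 0 < n%:R :> R by rewrite ltr0n.
have tail : (M ^ 2)%:R * (2 * expR (- (2 * n%:R * t ^+ 2))) = 2 / 3 * delta.
  have M2_gt0 : 0 < (M ^ 2)%:R :> R by rewrite natrX exprn_gt0.
  have M2_ge1 : 1 <= (M ^ 2)%:R :> R by rewrite ler1n -(ltr0n R).
  rewrite sqr_sqrtr; last first.
    rewrite divr_ge0 ?mulr_ge0 ?ler0n// ln_ge0// ler_pdivlMr// mul1r; lra.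
  rewrite [2 * n%:R * _]mulrC divfK ?gt_eqF ?mulr_gt0//.
  rewrite expRN lnK ?posrE ?divr_gt0 ?mulr_gt0//.
  by field; rewrite !gt_eqF.
apply: (@le_lt_trans _ _ (2 / 3 * delta)%:E); last by rewrite lte_fin; lra.
apply: ub_ereal_sup => _ [p _ <-].
have p_int := integrable_density p.
have [th thP thmin] := best_histogram b_gt0 p_int (hist_params_nonempty d b_gt0 k_gt0).
have -> : minimum [set L1dist p q | q in mvhist R d b k] =
    (L1norm (lebesgue_eucl R d) (fun x => p x - histogram th x))%:E.
  apply: minimumE.
    exists (histogram th); first by apply/mvhistP; exists th.
    by rewrite L1distE//; exact: integrable_histogram.
  move=> _ [q /mvhistP[th' th'P ->] <-].
  by rewrite L1distE ?lee_fin; [exact: thmin|by []|exact: integrable_histogram].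
set m := L1norm _ _; set r1 := 7 * _; set r2 := 7 * _.
rewrite (_ : mkset _ = [set s | (3 * m + r1 + r2 <
    L1norm (lebesgue_eucl R d) (fun x => p x - V s x))%R]); last first.
  apply/seteqP; split => s /=; rewrite (L1distE p_int (f_int _)).
    by rewrite -?EFinM -?EFinD lte_fin.
  by rewrite -?EFinM -?EFinD lte_fin.
have [a ha] := rep_net th thP.
rewrite -tail.
apply: (@minimum_distance_tail _ _ _ _ _ f [ffun=> ord0] n f_int
  (density_law p) p a t) => //.
- by rewrite Rintegral_histogram// /Rintegral integral_density.
- exact: sqrtr_ge0.
have := @rate_bound R d b k n K M delta d_gt0 b_gt0 k_gt0 n_gt0
  delta_gt0 delta_le1 erefl ME.
rewrite -/t -/r1 -/r2 -/N => rate.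
have := L1norm_histogram_lipschitz b_gt0 th (rep a) p_int.
rewrite ler_distl => /andP[h _].
rewrite /f -/m in h *; lra.
Qed.
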